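(* Let $R$ be a commutative Noetherian ring with nonzero identity and let $M$ be an $R$-module. Then the following statements are equivalent: (i) $M$ is a weakly Laskerian $R$-module; (ii) there is a finitely generated submodule $N$ of $M$ such that $\operatorname{Supp}_R(M/N)=\operatorname{Ass}_R(M/N)$ and $\operatorname{Supp}_R(M/N)$ is a finite set; (iii) $M$ is an FSF $R$-module.
   Context: For an $R$-module $X$, $\operatorname{Ass}_R(X)$ denotes the set of associated prime ideals of $X$ and $\operatorname{Supp}_R(X)$ denotes the support of $X$. An $R$-module $M$ is called weakly Laskerian if $\operatorname{Ass}_R(M/L)$ is a finite set for every submodule $L$ of $M$. An $R$-module $M$ is called an FSF module if there is a finitely generated submodule $N$ of $M$ such that $\operatorname{Supp}_R(M/N)$ is a finite set. The module $M$ is not assumed to be finitely generated. *)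

(* Defs.v *)
From HB Require Import structures.
From mathcomp Require Import all_boot all_order all_algebra.
From mathcomp Require Import all_classical.
From mathcomp Require Import ring.

Set Implicit Arguments.
Unset Strict Implicit.
Unset Printing Implicit Defensive.

Import GRing.Theory.
Local Open Scope ring_scope.
Local Open Scope quotient_scope.
Local Open Scope classical_set_scope.

(* Submodules of X are the elements of [submodClosed X]. The underlying
   predicate is boolean, which loses nothing classically (see [asbool]). *)

Definition fin_gen (R : comNzRingType) (X : lmodType R)
    (L : submodClosed X) : Prop :=
  exists s : seq X, forall x : X,
    x \in L <-> exists c : nat -> R, x = \sum_(i < size s) c i *: s`_i.

(* The ideals of R, including R itself, are the submodules of R^o; MathComp's
   [idealr R] only contains the proper ones. *)
Definition noetherian (R : comNzRingType) : Prop :=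
  forall I : submodClosed R^o, fin_gen I.

(* The library's quotient is by a [zmodClosed] predicate, and is only a
   zmodType. *)
Section QuotientModule.
Variables (R : comNzRingType) (X : lmodType R) (L : submodClosed X).

Definition submod_pred : {pred X} := fun x => x \in L.

Lemma submod_pred_zmod_closed : zmod_closed submod_pred.
Proof. exact: GRing.submod_closedB (submodClosedP L). Qed.

HB.instance Definition _ :=
  GRing.isZmodClosed.Build X submod_pred submod_pred_zmod_closed.

Definition quot_mod := Quotient.quot submod_pred.

HB.instance Definition _ := Choice.on quot_mod.
HB.instance Definition _ := EqQuotient.on quot_mod.
HB.instance Definition _ := GRing.Zmodule.on quot_mod.

Lemma quot_mod_eqE (x y : X) :
  (\pi_quot_mod x == \pi_quot_mod y) = (x - y \in L).
Proof. by rewrite -[RHS]/(x - y \in submod_pred) Quotient.idealrBE. Qed.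

Definition quot_scale (a : R) := lift_op1 quot_mod ( *:%R a).

Lemma pi_quot_scale a (x : X) :
  \pi_quot_mod (a *: x) = quot_scale a (\pi_quot_mod x).
Proof.
unlock quot_scale; apply/eqP.
rewrite quot_mod_eqE -scalerBr rpredZ //.
by rewrite -quot_mod_eqE reprK.
Qed.

Lemma pi_quot_add (x y : X) :
  \pi_quot_mod (x + y) = \pi_quot_mod x + \pi_quot_mod y.
Proof. exact: (@Quotient.pi_add X submod_pred). Qed.

Lemma quot_scaleA a b q : quot_scale a (quot_scale b q) = quot_scale (a * b) q.
Proof. by rewrite -[q]reprK -!pi_quot_scale scalerA. Qed.

Lemma quot_scale1 : left_id 1 quot_scale.
Proof. by move=> q; rewrite -[q]reprK -!pi_quot_scale scale1r. Qed.

Lemma quot_scaleDr : right_distributive quot_scale +%R.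
Proof.
move=> a p q; rewrite -[p]reprK -[q]reprK.
by rewrite -pi_quot_add -!pi_quot_scale -pi_quot_add scalerDr.
Qed.

Lemma quot_scaleDl q : {morph quot_scale^~ q : a b / a + b}.
Proof.
move=> a b; rewrite -[q]reprK.
by rewrite -!pi_quot_scale -pi_quot_add scalerDl.
Qed.

HB.instance Definition _ := GRing.Zmodule_isLmodule.Build R quot_mod
  quot_scaleA quot_scale1 quot_scaleDr quot_scaleDl.

End QuotientModule.

(* The localization X_P, as a module over R: fractions x/s with s outside P,
   where x/s = y/t iff u(tx - sy) = 0 for some u outside P. *)
Section Localization.
Variables (R : comNzRingType) (X : lmodType R) (P : prime_idealr R).

Definition denom := {s : R | s \notin P}.

Lemma denom1_subproof : 1 \notin P. Proof. by rewrite idealr1. Qed.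
Lemma denomM_subproof (s t : denom) : sval s * sval t \notin P.
Proof. by rewrite prime_idealrM negb_or (valP s) (valP t). Qed.

Definition denom1 : denom := Sub 1 denom1_subproof.
Definition denomM (s t : denom) : denom := Sub (sval s * sval t) (denomM_subproof s t).

Definition frac := (X * denom)%type.

Definition frac_equiv (f g : frac) : bool :=
  `[< exists u : denom, sval u *: (sval g.2 *: f.1 - sval f.2 *: g.1) = 0 >].

Lemma frac_equiv_is_equiv : equiv_class_of frac_equiv.
Proof.
split=> [f|f g|g f h].
- by apply/asboolP; exists denom1; rewrite subrr scaler0.
- by apply/asboolP/asboolP => -[u Hu]; exists u; rewrite -opprB scalerN Hu oppr0.
- move=> /asboolP[u Hu] /asboolP[v Hv]; apply/asboolP.
  exists (denomM (denomM u v) g.2) => /=.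
  have -> : sval u * sval v * sval g.2 *:
       (sval h.2 *: f.1 - sval f.2 *: h.1) =
     (sval v * sval h.2) *: (sval u *: (sval g.2 *: f.1 - sval f.2 *: g.1)) +
     (sval u * sval f.2) *: (sval v *: (sval h.2 *: g.1 - sval g.2 *: h.1)).
    rewrite !scalerBr !scalerA.
    have -> : sval v * sval h.2 * sval u * sval f.2
            = sval u * sval f.2 * sval v * sval h.2 by ring.
    by rewrite addrA addrNK; congr (_ *: _ - _ *: _); ring.
  by rewrite Hu Hv !scaler0 addr0.
Qed.

Canonical frac_equiv_equiv := EquivRelPack frac_equiv_is_equiv.
Canonical frac_equiv_encModRel := defaultEncModRel frac_equiv.

Definition localization := {eq_quot frac_equiv}.

HB.instance Definition _ := Choice.on localization.
HB.instance Definition _ : EqQuotient frac frac_equiv localization :=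
  EqQuotient.on localization.

Lemma loc_eqP (f g : frac) :
  \pi_localization f = \pi_localization g <->
  exists u : denom, sval u *: (sval g.2 *: f.1 - sval f.2 *: g.1) = 0.
Proof.
split=> [/eqP|H]; first by rewrite piE => /asboolP.
by apply/eqP; rewrite piE; apply/asboolP.
Qed.

Definition frac_zero : frac := (0, denom1).
Definition frac_add (f g : frac) : frac :=
  (sval g.2 *: f.1 + sval f.2 *: g.1, denomM f.2 g.2).
Definition frac_opp (f : frac) : frac := (- f.1, f.2).
Definition frac_scale (a : R) (f : frac) : frac := (a *: f.1, f.2).

Definition loc_zero : localization := \pi_localization frac_zero.
Definition loc_add := lift_op2 localization frac_add.
Definition loc_opp := lift_op1 localization frac_opp.
Definition loc_scale (a : R) := lift_op1 localization (frac_scale a).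

Lemma pi_loc_add (f g : frac) :
  \pi_localization (frac_add f g) =
  loc_add (\pi_localization f) (\pi_localization g).
Proof.
unlock loc_add; apply/loc_eqP.
have /loc_eqP[u Hu] := esym (reprK (\pi_localization f)).
have /loc_eqP[v Hv] := esym (reprK (\pi_localization g)).
set f' := repr _ in Hu *; set g' := repr _ in Hv *.
exists (denomM u v) => /=.
transitivity
  ((sval v * sval g.2 * sval g'.2) *: (sval u *: (sval f'.2 *: f.1 - sval f.2 *: f'.1))
 + (sval u * sval f.2 * sval f'.2) *: (sval v *: (sval g'.2 *: g.1 - sval g.2 *: g'.1))).
  rewrite !(scalerBr, scalerDr) !scalerA opprD addrACA.
  by congr (_ *: _ - _ *: _ + (_ *: _ - _ *: _)); ring.
by rewrite Hu Hv !scaler0 addr0.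
Qed.

Lemma pi_loc_opp (f : frac) :
  \pi_localization (frac_opp f) = loc_opp (\pi_localization f).
Proof.
unlock loc_opp; apply/loc_eqP.
have /loc_eqP[u Hu] := esym (reprK (\pi_localization f)).
by exists u => /=; rewrite !scalerN -opprD scalerN Hu oppr0.
Qed.

Lemma pi_loc_scale a (f : frac) :
  \pi_localization (frac_scale a f) = loc_scale a (\pi_localization f).
Proof.
unlock loc_scale; apply/loc_eqP.
have /loc_eqP[u Hu] := esym (reprK (\pi_localization f)).
exists u => /=; set f' := repr _ in Hu *.
transitivity (a *: (sval u *: (sval f'.2 *: f.1 - sval f.2 *: f'.1))).
  by rewrite !scalerBr !scalerA; congr (_ *: _ - _ *: _); ring.
by rewrite Hu scaler0.
Qed.

Lemma frac_eq (f g : frac) : f.1 = g.1 -> sval f.2 = sval g.2 -> f = g.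
Proof. by case: f g => [x s] [y t] /= -> /val_inj ->. Qed.

Lemma loc_addA : associative loc_add.
Proof.
move=> p q r; rewrite -[p]reprK -[q]reprK -[r]reprK -!pi_loc_add.
congr (\pi_localization _); apply: frac_eq => /=; last by rewrite mulrA.
by rewrite !scalerDr !scalerA addrA; congr (_ *: _ + _ *: _ + _ *: _); ring.
Qed.

Lemma loc_addC : commutative loc_add.
Proof.
move=> p q; rewrite -[p]reprK -[q]reprK -!pi_loc_add.
by congr (\pi_localization _); apply: frac_eq; rewrite /= 1?addrC 1?mulrC.
Qed.

Lemma loc_add0 : left_id loc_zero loc_add.
Proof.
move=> p; rewrite -[p]reprK -pi_loc_add.
congr (\pi_localization _); apply: frac_eq; rewrite /= ?mul1r //.
by rewrite scaler0 add0r scale1r.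
Qed.

Lemma loc_addN : left_inverse loc_zero loc_opp loc_add.
Proof.
move=> p; rewrite -[p]reprK -pi_loc_opp -pi_loc_add.
by apply/loc_eqP; exists denom1 => /=; rewrite scalerN addNr !scaler0 subrr scaler0.
Qed.

HB.instance Definition _ :=
  GRing.isZmodule.Build localization loc_addA loc_addC loc_add0 loc_addN.

Lemma loc_scaleA a b p : loc_scale a (loc_scale b p) = loc_scale (a * b) p.
Proof.
rewrite -[p]reprK -!pi_loc_scale.
by congr (\pi_localization _); apply: frac_eq; rewrite //= scalerA.
Qed.

Lemma loc_scale1 : left_id 1 loc_scale.
Proof.
move=> p; rewrite -[p]reprK -!pi_loc_scale.
by congr (\pi_localization _); apply: frac_eq; rewrite //= scale1r.
Qed.

Lemma loc_scaleDr : right_distributive loc_scale +%R.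
Proof.
move=> a p q; rewrite -[p]reprK -[q]reprK -![_ + _]pi_loc_add.
rewrite -!pi_loc_scale -![RHS]pi_loc_add.
congr (\pi_localization _); apply: frac_eq => //=.
by rewrite scalerDr !scalerA; congr (_ *: _ + _ *: _); ring.
Qed.

Lemma loc_scaleDl p : {morph loc_scale^~ p : a b / a + b}.
Proof.
move=> a b; rewrite -[p]reprK -!pi_loc_scale -![RHS]pi_loc_add.
apply/loc_eqP; exists denom1 => /=.
set s := repr p.
rewrite -scalerDr -scalerDl !scalerA -scalerBl scalerA.
by rewrite (_ : _ * _ = 0) ?scale0r //; ring.
Qed.

HB.instance Definition _ := GRing.Zmodule_isLmodule.Build R localization
  loc_scaleA loc_scale1 loc_scaleDr loc_scaleDl.

End Localization.

(* Prime ideals are recorded by their underlying sets; the bundled type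
   [prime_idealr R] is too large to be an argument of [set]. *)
Section AssSupp.
Variables (R : comNzRingType) (X : lmodType R).

Definition Ass : set (set R) :=
  [set p | exists2 P : prime_idealr R, p = [set` P] &
           exists x : X, p = [set a | a *: x = 0]].

Definition Supp : set (set R) :=
  [set p | exists2 P : prime_idealr R, p = [set` P] &
           exists y : localization X P, y <> 0].

End AssSupp.
Arguments Ass {R} X.
Arguments Supp {R} X.

Section Properties.
Variables (R : comNzRingType) (M : lmodType R).

Definition weakly_Laskerian : Prop :=
  forall L : submodClosed M, finite_set (Ass (quot_mod L)).

Definition FSF : Prop :=
  exists2 N : submodClosed M, fin_gen N & finite_set (Supp (quot_mod N)).

End Properties.
Arguments weakly_Laskerian {R} M.
Arguments FSF {R} M.

(* Main.v *)
From HB Require Import structures.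
Require Import Defs.
From mathcomp Require Import all_boot all_order all_algebra.
From mathcomp Require Import all_classical.
From mathcomp Require Import finmap ring.

(** All submodules of the fixed module [X] are handled as sets, and a quotient
    [X / L] is never formed: its associated primes are the primes of the form
    [L : x], its support consists of the primes containing some [L : x], and
    the two are translated to actual quotients and localizations only
    at the very end ([Ass_quot], [Supp_quot]).

    A module with a finitely generated submodule [N] such that [X / N] has
    finite support is weakly Laskerian because the associated primes of [X / L]
    lie in those of [(N + L) / L], a finitely generated module over a
    Noetherian ring, or in the support of [X / (N + L)]; this is
    [finite_supp_finite_assoc].

    The converse rests on a construction of a submodule [L] with infinitely
    many associated primes [q_0, q_1, ...] in the quotient, generated by
    multiples [q_i z_i]. Suppose [z_0, ..., z_(n-1)] are chosen, with span [K]
    and with [L_n] the sum of the [q_i z_i]. Take an associated prime [p] of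
    [X / K], say [p = K : x], and a new prime [q_n] containing [p], such that no
    earlier [q_i] is contained in [p]. Since the product of the [q_i] carries
    [K] into [L_n], some [b] outside [p] does too. The ideals
    [L_n : b ^+ m *: x] increase, hence stabilize, and for such an [m] the
    element [z_n = b ^+ m *: x] has the property that [R z_n] meets [K] inside
    [L_n]. So adding [q_n z_n] creates the annihilator [q_n] and leaves the
    annihilators of the earlier [z_i] intact ([witnesses_extend],
    [exists_infinite_assoc]). This replaces the Artin-Rees lemma by the
    ascending chain condition on ideals.

    Call a prime bad if infinitely many primes contain it. If [X] is weakly
    Laskerian and no finitely generated [N] gives [X / N] a finite support,
    then every support of such an [X / N] contains a bad prime. Either one bad
    prime [p] lies in all these supports, and the [q_i] can be chosen among
    the primes strictly above [p]; or each bad prime leaves the support for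
    some [N], and the [q_i] can be chosen among the maximal bad primes. Both
    cases contradict weak Laskerianness ([finite_assoc_finite_supp]).

    Finally, take [N] such that the support of [X / N] is finite and as small
    as possible. Enlarging [N] no longer changes the support, so its minimal
    primes always stay associated, and any other prime [q] of the support can
    be made associated: if [p] is minimal below [q] and [p = N : z], replace
    [N] by [N + q z] ([exists_supp_eq_assoc]). *)

Set Implicit Arguments.
Unset Strict Implicit.
Unset Printing Implicit Defensive.

Import GRing.Theory.
Local Open Scope ring_scope.
Local Open Scope quotient_scope.
Local Open Scope classical_set_scope.

(** * Choice and finiteness *)

Lemma dependent_chain (T : Type) (P : T -> Prop) (E : T -> T -> Prop) (x0 : T) :
  P x0 -> (forall x, P x -> exists2 y, P y & E x y) ->
  exists2 f : nat -> T, f 0%N = x0 & forall n, P (f n) /\ E (f n) (f n.+1).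
Proof.
move=> Px0 PE; pose E' (u v : {x | P x}) := E (sval u) (sval v).
have E'E u : {v | E' u v}.
  have [y Py uy] := cid2 (PE _ (svalP u)).
  by exists (exist _ y Py).
have [f [f0 fE]] := dependent_choice E'E (exist _ x0 Px0).
exists (sval \o f) => [|n] /=; first by rewrite f0.
by split; [exact: svalP | exact: fE].
Qed.

(** Induction on the cardinality of a finite member of the family. *)
Lemma finite_minimal (T : choiceType) (F : set (set T)) (A : set T) :
  finite_set A -> F A ->
  exists B, [/\ B `<=` A, F B & forall C, F C -> C `<=` B -> C = B].
Proof.
have [n] := ubnP #|` fset_set A|; elim: n A => // n IHn A cardA finA FA.
have [minA|] := pselect (forall C, F C -> C `<=` A -> C = A).
  by exists A; split.
move=> /existsNP[C] /not_implyP[FC] /not_implyP[CA /eqP CneA].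
have finC : finite_set C := sub_finite_set CA finA.
have cardC : (#|` fset_set C| < #|` fset_set A|)%N.
  apply: fproper_ltn_card; rewrite fproperEneq.
  apply/andP; split; last by rewrite -fset_set_sub.
  apply: contra CneA => /eqP eqCA; apply/eqP.
  by rewrite -(fset_setK finC) eqCA fset_setK.
have [B [BC FB minB]] := IHn C (leq_trans cardC cardA) finC FC.
by exists B; split=> //; apply: subset_trans BC CA.
Qed.

Definition set_pred (T : Type) (A : set T) : {pred T} := fun x => `[< A x >].

(** * Submodules, colon ideals and primes as sets *)

Section Submodules.
Variables (R : comNzRingType) (X : lmodType R).
Implicit Types (A L : set X) (I p : set R).

Definition submodule A : Prop :=
  A 0 /\ forall a x y, A x -> A y -> A (a *: x + y).

Definition colon A (x : X) : set R := [set a | A (a *: x)].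

(** The submodule [A + I z]. *)
Definition adjoin A (I : set R) (z : X) : set X :=
  [set x | exists y b, [/\ A y, I b & x = y + b *: z]].

Definition add_span A (s : seq X) : set X :=
  foldr (fun z B => adjoin B setT z) A s.

Section Closure.
Variable A : set X.
Hypothesis subA : submodule A.

Lemma submodule0 : A 0. Proof. by case: subA. Qed.

Lemma submoduleD x y : A x -> A y -> A (x + y).
Proof. by case: subA => _ AD Ax Ay; rewrite -[x]scale1r; apply: AD. Qed.

Lemma submoduleZ a x : A x -> A (a *: x).
Proof. by case: subA => A0 AD Ax; rewrite -[_ *: _]addr0; apply: AD. Qed.

Lemma submoduleN x : A x -> A (- x).
Proof. by move=> Ax; rewrite -scaleN1r; apply: submoduleZ. Qed.

Lemma submoduleB x y : A x -> A y -> A (x - y).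
Proof. by move=> Ax /submoduleN; apply: submoduleD. Qed.

Lemma submodule_addl x y : A y -> A (x + y) -> A x.
Proof. by move=> Ay Axy; rewrite -(addrK y x); apply: submoduleB. Qed.

Lemma submodule_pred_closed : GRing.subsemimod_closed (set_pred A).
Proof.
split; first split.
- by apply/asboolP; exact: submodule0.
- by move=> x y /asboolP Ax /asboolP Ay; apply/asboolP; exact: submoduleD.
- by move=> a x /asboolP Ax; apply/asboolP; exact: submoduleZ.
Qed.

End Closure.

(** Predicates are boolean in the bundled structures, so classical
    decidability of membership is what allows any submodule to be bundled. *)
Lemma submodule_bundle A : submodule A ->
  exists L : submodClosed X, [set` L] = A.
Proof.
move=> subA.
pose H := GRing.isSubmodClosed.Build R X _ (submodule_pred_closed subA).
pose L : submodClosed X := HB.pack (set_pred A) H.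
by exists L; apply/seteqP; split=> x /= /asboolP.
Qed.

Lemma submodule_submodClosed (L : submodClosed X) : submodule [set` L].
Proof.
by split=> [|a x y] /= *; rewrite ?rpred0 ?rpredD ?rpredZ.
Qed.

Lemma submodule_set0 : submodule [set 0].
Proof. by split=> // a x y /= -> ->; rewrite scaler0 addr0. Qed.

End Submodules.

Definition ideal (R : comNzRingType) (I : set R) := @submodule R R^o I.

Definition prime_ideal (R : comNzRingType) (p : set R) : Prop :=
  [/\ ideal p, ~ p 1 & forall a b, p (a * b) -> p a \/ p b].

Section Primes.
Variable R : comNzRingType.
Implicit Types (I p : set R).

Lemma idealM I a b : ideal I -> I b -> I (a * b).
Proof. by move=> idI; apply: (submoduleZ idI). Qed.

Lemma prime_ideal_bundle p :
  prime_ideal p <-> exists P : prime_idealr R, p = [set` P].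
Proof.
split=> [[idp p1 pM]|[P ->]].
  have clp : idealr_closed (set_pred p).
    split; first by apply/asboolP; exact: submodule0 idp.
      by apply/asboolP.
    by move=> a x y /asboolP px /asboolP py; apply/asboolP; apply: idp.2.
  have prp : prime_idealr_closed (set_pred p).
    by move=> a b /asboolP /pM [?|?]; apply/orP; [left|right]; apply/asboolP.
  pose H1 := isIdealr.Build R _ clp.
  pose H2 := isPrimeIdealrClosed.Build R _ prp.
  pose P : prime_idealr R := HB.pack (set_pred p) H1 H2.
  by exists P; apply/seteqP; split=> x /= /asboolP.
split=> [|/=|a b /=]; last by rewrite prime_idealrM => /orP.
  split=> [|a x y] /= *; first exact: rpred0.
  by rewrite rpredD // idealMr.
by rewrite idealr1.
Qed.

Lemma prime_idealX p a b n : prime_ideal p -> ~ p a -> p (a ^+ n * b) -> p b.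
Proof.
move=> [_ _ pM] pa; elim: n => [|n IHn]; first by rewrite expr0 mul1r.
by rewrite exprS -mulrA => /pM [].
Qed.

End Primes.

Section Spans.
Variables (R : comNzRingType) (X : lmodType R).
Implicit Types (A L : set X) (I p : set R).

Lemma submodule_colon A x : submodule A -> ideal (colon A x).
Proof.
move=> subA; split=> [|a b c Ab Ac].
  by rewrite /colon /= scale0r; exact: submodule0.
rewrite /colon /= scalerDl -scalerA.
by apply: submoduleD => //; exact: submoduleZ.
Qed.

Lemma colonZ A b x a : colon A (b *: x) a = colon A x (a * b).
Proof. by rewrite /colon /= scalerA. Qed.

Lemma sub_colonZ A b x : submodule A -> colon A x `<=` colon A (b *: x).
Proof.
by move=> subA a Aax; rewrite colonZ mulrC; exact: idealM (submodule_colon _ _) _.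
Qed.

Lemma submodule_adjoin A I z : submodule A -> ideal I -> submodule (adjoin A I z).
Proof.
move=> subA idI; split=> [|a _ _ [x [b [Ax Ib ->]]] [y [c [Ay Ic ->]]]].
  by exists 0, 0; rewrite scale0r addr0; split=> //; [case: subA | case: idI].
exists (a *: x + y), (a * b + c).
split; [by apply: subA.2 | by apply: idI.2 |].
by rewrite scalerDr scalerDl scalerA addrACA.
Qed.

Lemma sub_adjoin A I z : ideal I -> A `<=` adjoin A I z.
Proof.
by move=> idI x Ax; exists x, 0; rewrite scale0r addr0; split=> //; case: idI.
Qed.

Lemma adjoin_mono A B I z : A `<=` B -> adjoin A I z `<=` adjoin B I z.
Proof. by move=> AB _ [y [b [Ay Ib ->]]]; exists y, b; split=> //; exact: AB. Qed.

Lemma submodule_add_span A s : submodule A -> submodule (add_span A s).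
Proof.
by move=> subA; elim: s => //= z s; move=> ?; apply: submodule_adjoin.
Qed.

Lemma sub_add_span A s : A `<=` add_span A s.
Proof.
elim: s => //= z s IHs; apply: subset_trans IHs _; exact: sub_adjoin.
Qed.

Lemma add_span_mono A B s : A `<=` B -> add_span A s `<=` add_span B s.
Proof. by move=> AB; elim: s => //= z s; exact: adjoin_mono. Qed.

Lemma add_span_cat A s t : add_span A (s ++ t) = add_span (add_span A t) s.
Proof. by rewrite /add_span foldr_cat. Qed.

Definition span (s : seq X) : set X := add_span [set 0] s.

Lemma submodule_span s : submodule (span s).
Proof. exact/submodule_add_span/submodule_set0. Qed.

Lemma span_catl s t : span s `<=` span (s ++ t).
Proof.
rewrite /span add_span_cat; apply: add_span_mono => _ ->.
exact: submodule0 (submodule_span t).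
Qed.

Lemma span_catr s t : span t `<=` span (s ++ t).
Proof. by rewrite /span add_span_cat; exact: sub_add_span. Qed.

Lemma mem_span s z : z \in s -> span s z.
Proof.
elim: s => //= y s IHs; rewrite inE => /orP[/eqP ->|/IHs sz].
  exists 0, 1; split=> //; last by rewrite scale1r add0r.
  exact: submodule0 (submodule_span s).
exact: sub_adjoin.
Qed.

Lemma span_sub A s : submodule A -> (forall z, z \in s -> A z) -> span s `<=` A.
Proof.
move=> subA; elim: s => [_ _ ->|z s IHs sA _ [y [b [sy _ ->]]]].
  exact: submodule0 subA.
apply: submoduleD => //; last by apply: submoduleZ => //; apply: sA; rewrite mem_head.
by apply: IHs => // t ts; apply: sA; rewrite inE ts orbT.
Qed.

Lemma span_sumP s x :
  span s x <-> exists c : nat -> R, x = \sum_(i < size s) c i *: s`_i.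
Proof.
elim: s x => [|z s IHs] x /=.
  split=> [->|[c ->]]; last by rewrite big_ord0.
  by exists (fun=> 0); rewrite big_ord0.
split=> [[y [b [/IHs[c ->] _ ->]]]|[c ->]].
  exists (fun n => if n is m.+1 then c m else b).
  by rewrite big_ord_recl addrC.
rewrite big_ord_recl addrC; eexists _, (c 0%N); split=> //.
by apply/IHs; exists (c \o S).
Qed.

Lemma fin_gen_span (L : submodClosed X) :
  fin_gen L <-> exists s, [set` L] = span s.
Proof.
split=> -[s Ls]; exists s; last by move=> x; rewrite -span_sumP -Ls.
by apply/seteqP; split=> x; rewrite span_sumP /= -Ls.
Qed.


End Spans.

Lemma adjoin_set0 (R : comNzRingType) (X : lmodType R) (A : set X) z :
  adjoin A [set 0] z = A.
Proof.
apply/seteqP; split=> [_ [y [_ [Ay -> ->]]]|x Ax].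
  by rewrite scale0r addr0.
by exists x, 0; rewrite scale0r addr0.
Qed.

(** If [g] generates the ideal [I] then the products [a *: z], for [a] in [g],
    generate [I z]: over a Noetherian ring, adding [I z] to a finitely generated
    submodule keeps it finitely generated. *)
Lemma adjoin_span (R : comNzRingType) (X : lmodType R)
    (A : set X) (g : seq R) z :
  adjoin A (@span R R^o g) z = add_span A [seq a *: z | a <- g].
Proof.
elim: g => [|a g IHg] /=; first exact: adjoin_set0.
rewrite -IHg; apply/seteqP; split.
  move=> _ [y [_ [Ay [b [c [gb _ ->]]] ->]]]; exists (y + b *: z), c.
  by rewrite scalerDl scalerA addrA; split=> //; exists y, b.
move=> _ [_ [c [[y [b [Ay gb ->]]] _ ->]]].
by exists y, (b + c * a); rewrite scalerDl scalerA addrA; split=> //; exists b, c.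
Qed.


Section Noetherian.
Variable R : comNzRingType.
Hypothesis noethR : noetherian R.

Lemma noetherian_ideal_span (I : set R) : ideal I -> exists g, I = @span R R^o g.
Proof.
move=> idI; have [L LI] := submodule_bundle idI.
by have /fin_gen_span[g] := noethR L; rewrite LI; exists g.
Qed.

(** Without a maximal element there is a strictly increasing sequence of ideals
    in the family; the finitely many generators of its union all occur at one
    stage, where the sequence must stop. *)
Lemma noetherian_maximal (F : set (set R)) (I0 : set R) :
  (forall I, F I -> ideal I) -> F I0 ->
  exists I, F I /\ forall J, F J -> I `<=` J -> J = I.
Proof.
move=> idF FI0; apply: contrapT => /forallNP noMax.
have [|f f0 /all_and2[fF fE]] := @dependent_chain _ F
    (fun I J => I `<=` J /\ J <> I) _ FI0.
  move=> I FI; have /not_andP[//|/existsNP[J]] := noMax I.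
  by move=> /not_implyP[FJ /not_implyP[IJ JI]]; exists J.
have fmono m n : (m <= n)%N -> f m `<=` f n.
  move=> /subnK <-; elim: (n - m)%N => [|k IHk] //.
  by apply: subset_trans IHk _; exact: (fE _).1.
pose U := \bigcup_n f n.
have idU : ideal U.
  split=> [|a x y [m _ fx] [n _ fy]].
    by exists 0%N => //; have [] := idF _ (fF 0%N).
  exists (maxn m n) => //; apply: (idF _ (fF _)).2.
    exact: fmono (leq_maxl m n) _ fx.
  exact: fmono (leq_maxr m n) _ fy.
have [g Ug] := noetherian_ideal_span idU.
have [n gn] : exists n, forall z, z \in g -> f n z.
  have : forall z, z \in g -> U z by rewrite Ug; exact: mem_span.
  elim: (g) => [|z t IHt] tU; first by exists 0%N.
  have [k _ fz] := tU z (mem_head _ _).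
  have [|n tn] := IHt; first by move=> y yt; apply: tU; rewrite inE yt orbT.
  exists (maxn k n) => y; rewrite inE => /orP[/eqP ->|/tn fy].
    exact: fmono (leq_maxl k n) _ fz.
  exact: fmono (leq_maxr k n) _ fy.
apply: (fE n).2; apply/seteqP; split; last exact: (fE n).1.
move=> x fx; have : U x by exists n.+1.
by rewrite Ug; apply: span_sub; first exact: idF (fF n).
Qed.

(** * Associated primes and supports *)

Variable X : lmodType R.
Implicit Types (A L N : set X) (p q : set R).

(** For submodules [L] and [N], these are the associated primes of
    [(N + L) / L]. *)
Definition assoc_in L N : set (set R) :=
  [set p | prime_ideal p /\ exists2 x, N x & p = colon L x].

(** The associated primes of [X / L]. *)
Definition assoc L := assoc_in L setT.

(** The support of [X / L]: the class of [x] is nonzero in the localization at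
    [p] exactly when no element outside [p] carries [x] into [L]. *)
Definition supp L : set (set R) :=
  [set p | prime_ideal p /\ exists x, colon L x `<=` p].

Lemma assoc_in_mono L N N' : N `<=` N' -> assoc_in L N `<=` assoc_in L N'.
Proof. by move=> NN' p [pp [x Nx px]]; split=> //; exists x => //; exact: NN'. Qed.

Lemma assoc_supp L : assoc L `<=` supp L.
Proof. by move=> p [pp [x _ px]]; split=> //; exists x; rewrite px. Qed.

Lemma supp_anti L L' : L `<=` L' -> supp L' `<=` supp L.
Proof.
move=> LL' p [pp [x px]]; split=> //; exists x => a La; exact/px/LL'.
Qed.

Lemma supp_up L p q : supp L p -> prime_ideal q -> p `<=` q -> supp L q.
Proof.
by move=> [_ [x px]] qq pq; split=> //; exists x; apply: subset_trans px pq.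
Qed.

(** Among the annihilators [L : x] contained in [p], a maximal one is prime. *)
Lemma supp_assoc L p : submodule L -> supp L p ->
  exists2 q, assoc L q & q `<=` p.
Proof.
move=> subL [[idp p1 pM] [x0 px0]].
pose F : set (set R) := [set I | I `<=` p /\ exists x, I = colon L x].
have idF I : F I -> ideal I by move=> [_ [x ->]]; exact: submodule_colon.
have Fx0 : F (colon L x0) by split=> //; exists x0.
have [q [[qp [x qx]] maxq]] := noetherian_maximal idF Fx0.
exists q => //; split; last by exists x.
split; [by rewrite qx; exact: submodule_colon|by move/qp|].
(* If [b *: x] dies at [p] then a multiple [s *: x] with [s] outside [p] is
   killed by [b]; otherwise its annihilator is that of [x]. *)
move=> a b qab; have [bxp|] := pselect (colon L (b *: x) `<=` p).
  left; rewrite -(maxq (colon L (b *: x))).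
  - by rewrite colonZ -qx.
  - by split=> //; exists (b *: x).
  - by rewrite qx; exact: sub_colonZ.
move=> /existsNP[s /not_implyP[sbx ps]].
right; rewrite -(maxq (colon L (s *: x))).
- by move: sbx; rewrite !colonZ mulrC.
- split; last by exists (s *: x).
  move=> t; rewrite colonZ -qx => /qp /pM[] //.
- by rewrite qx; exact: sub_colonZ.
Qed.

(** * Finiteness of associated primes *)

(** Every nonzero element of [R / p] has annihilator [p]. *)
Lemma assoc_colon_mul p L x a : prime_ideal p -> p = colon L x -> ~ p a ->
  colon L (a *: x) = p.
Proof.
move=> [idp _ pM] px pa; apply/seteqP; split=> b; rewrite colonZ -px.
  by move=> /pM[].
by rewrite mulrC; exact: idealM.
Qed.

(** If [p = L : x], then [R x + L] modulo [L] is a copy of [R / p]. Either a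
    nonzero element of it lies in [L' / L], and has annihilator [p], or the copy
    of [R / p] embeds in the quotient by [L']. *)
Lemma assoc_in_extension L L' N :
  submodule L -> L `<=` L' -> assoc_in L N `<=` assoc_in L L' `|` assoc_in L' N.
Proof.
move=> subL LL' p [pp [x Nx px]].
have [[a [pa Lax]]|noa] := pselect (exists a, ~ p a /\ L' (a *: x)).
  by left; split=> //; exists (a *: x) => //; rewrite (assoc_colon_mul pp px).
right; split=> //; exists x => //; apply/seteqP; split=> a.
  by rewrite px => /LL'.
by move=> L'ax; apply: contrapT => pa; apply: noa; exists a.
Qed.

Lemma assoc_in_adjoin L z p : submodule L -> assoc_in L (adjoin L setT z) p ->
  exists r, p = colon L (r *: z).
Proof.
move=> subL [_ [_ [y [r [Ly _ ->]]] ->]]; exists r.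
apply/seteqP; split=> a; rewrite /colon /= scalerDr.
  by rewrite addrC; apply: submodule_addl => //; exact: submoduleZ.
by move=> Lrz; apply: submoduleD => //; exact: submoduleZ.
Qed.

(** Noetherian induction on [L : z], the annihilator of the cyclic module
    [(R z + L) / L]. If [p = L : r z] is an associated prime, then the submodule
    generated by [r z] is a copy of [R / p], which contributes [p] only, and the
    quotient by it is cyclic with a larger annihilator. *)
Lemma finite_assoc_in_adjoin L z :
  submodule L -> finite_set (assoc_in L (adjoin L setT z)).
Proof.
move=> subL0; apply: contrapT => infL0.
pose F : set (set R) := [set I | exists L,
  [/\ submodule L, ~ finite_set (assoc_in L (adjoin L setT z)) & I = colon L z]].
have idF I : F I -> ideal I by move=> [? [? _ ->]]; exact: submodule_colon.
have FL0 : F (colon L z) by exists L.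
have {L subL0 infL0 FL0} [_ [[L [subL infL ->]] maxL]] :=
  noetherian_maximal idF FL0.
have [p pL] : assoc_in L (adjoin L setT z) !=set0 by exact: infinite_setN0 infL.
have [r prz] := assoc_in_adjoin subL pL.
have [[idp p1 pM] _] := pL.
pose L' := adjoin L setT (r *: z).
have subL' : submodule L' by exact: submodule_adjoin.
have LL' : L `<=` L' by exact: sub_adjoin.
(* [r] annihilates [z] modulo [L'] but not modulo [L], as [p] is proper. *)
have finL' : finite_set (assoc_in L' (adjoin L' setT z)).
  apply: contrapT => infL'.
  have eqLL' : colon L' z = colon L z.
    by apply: maxL; [exists L' | move=> a /LL'].
  apply: p1; rewrite prz colonZ mul1r -eqLL'.
  exists 0, 1; split=> //; last by rewrite scale1r add0r.
  exact: submodule0 subL.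
apply: infL; apply: (@sub_finite_set _ _ ([set p] `|` assoc_in L' (adjoin L' setT z))).
  apply: subset_trans (assoc_in_extension subL LL') _; apply: setUSS.
    move=> q qL; have [s qs] := assoc_in_adjoin subL qL.
    have [[_ q1 _] _] := qL.
    rewrite qs; apply: (assoc_colon_mul _ prz); first by case: pL.
    move=> ps; apply: q1; rewrite qs colonZ mul1r.
    by rewrite prz in ps.
  apply: assoc_in_mono; exact: adjoin_mono.
by rewrite finite_setU; split=> //; exact: finite_set1.
Qed.

Lemma finite_assoc_in_add_span L s :
  submodule L -> finite_set (assoc_in L (add_span L s)).
Proof.
move=> subL; elim: s => [|z s IHs].
  apply: sub_finite_set (finite_assoc_in_adjoin 0 subL).
  by apply: assoc_in_mono; exact: sub_adjoin.
have subLs := submodule_add_span s subL.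
apply: sub_finite_set (assoc_in_extension subL (@sub_add_span _ _ L s)) _.
by rewrite finite_setU; split=> //; exact: finite_assoc_in_adjoin.
Qed.

Lemma finite_supp_finite_assoc s L :
  finite_set (supp (span s)) -> submodule L -> finite_set (assoc L).
Proof.
move=> finS subL.
apply: sub_finite_set (assoc_in_extension subL (@sub_add_span _ _ L s)) _.
rewrite finite_setU; split; first exact: finite_assoc_in_add_span.
apply: sub_finite_set finS; apply: subset_trans (@assoc_supp _) (supp_anti _).
by apply: add_span_mono => _ ->; exact: submodule0 subL.
Qed.

(** * A submodule with prescribed associated primes *)

(** In a list of pairs [(z_i, q_i)], the latest pair comes first. [firsts] is
    the span [K] of the [z_i], and [multiples] is the sum of the [q_i z_i]. *)
Definition firsts (s : seq (X * set R)) : set X := span [seq zq.1 | zq <- s].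

Definition multiples (s : seq (X * set R)) : set X :=
  foldr (fun zq A => adjoin A zq.2 zq.1) [set 0] s.

(** The invariant of the construction. The third clause says that a new pair
    [(z, q)] does not change the sum of multiples within the span of the earlier
    elements, so that their annihilators are preserved; the last one is the
    inclusion that makes [q] the exact annihilator of [z]. *)
Fixpoint witnesses (C : set (set R)) (s : seq (X * set R)) : Prop :=
  if s is (z, q) :: t then
    [/\ witnesses C t, C q /\ q \notin [seq zq.2 | zq <- t],
        firsts t `&` multiples s `<=` multiples t &
        colon (multiples s) z `<=` q]
  else True.

Section Construction.
Variable C : set (set R).
Hypothesis primeC : C `<=` @prime_ideal R.

Lemma witnesses_mem s q : witnesses C s -> q \in [seq zq.2 | zq <- s] -> C q.
Proof.
elim: s => //= -[z p] t IHt [Ct [Cp _] _ _].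
by rewrite inE => /orP[/eqP ->|/(IHt Ct)].
Qed.

Lemma submodule_multiples s : witnesses C s -> submodule (multiples s).
Proof.
elim: s => [_|[z q] t IHt [Ct [Cq _] _ _]]; first exact: submodule_set0.
by apply: submodule_adjoin; [exact: IHt | case: (primeC Cq)].
Qed.

Lemma multiples_firsts s : multiples s `<=` firsts s.
Proof.
elim: s => //= -[z q] t IHt _ [y [b [ty _ ->]]].
by exists y, b; split=> //; exact: IHt.
Qed.

(** Each [q_i] kills [z_i] modulo the multiples; a product of elements of the
    [q_i] outside the prime [p] kills all of [firsts s] and is outside [p]. *)
Lemma firsts_kill s p : witnesses C s -> prime_ideal p ->
    (forall q, q \in [seq zq.2 | zq <- s] -> ~ q `<=` p) ->
  exists2 b, ~ p b & forall x, firsts s x -> multiples s (b *: x).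
Proof.
move=> Cs [idp p1 pM]; elim: s Cs => [_ _|[z q] t IHt [Ct [Cq _] _ _] qsp].
  by exists 1 => // _ ->; rewrite scaler0.
have [|b pb tb] := IHt Ct; first by move=> r rt; apply: qsp; rewrite inE rt orbT.
have /existsNP[c /not_implyP[qc pc]] := qsp q (mem_head _ _).
exists (c * b); first by move=> /pM[].
move=> _ [y [a [ty _ ->]]]; exists (c *: (b *: y)), (b * a * c).
have [idq _ _] := primeC Cq.
split; first by apply: submoduleZ; [exact: submodule_multiples | exact: tb].
  exact: idealM.
by rewrite scalerDr !scalerA; congr (_ + _ *: _); ring.
Qed.

(** With [p = firsts s : x], take [b] outside [p] as in [firsts_kill] and
    [z = b ^+ n *: x], where the ideals [multiples s : b ^+ n *: x] are stable.
    If [c *: z] lies in [firsts s], then [b * c] carries [z] into [multiples s],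
    hence so does [c] by stability. Moreover [z] still has annihilator [p]
    modulo [firsts s], so adding [q z] gives it the annihilator [q]. *)
Lemma witnesses_extend s p q : witnesses C s -> assoc (firsts s) p ->
    C q -> p `<=` q -> q \notin [seq zq.2 | zq <- s] ->
    (forall r, r \in [seq zq.2 | zq <- s] -> ~ r `<=` p) ->
  exists z, witnesses C ((z, q) :: s).
Proof.
move=> Cs [pp [x _ px]] Cq pq qs sp.
have [b pb bK] := firsts_kill Cs pp sp.
have subL := submodule_multiples Cs.
have subK : submodule (firsts s) by exact: submodule_span.
have [idp _ _] := pp; have [idq _ _] := primeC Cq.
pose F : set (set R) := [set I | exists n, I = colon (multiples s) (b ^+ n *: x)].
have idF I : F I -> ideal I by move=> [n ->]; exact: submodule_colon.
have F0 : F (colon (multiples s) (b ^+ 0 *: x)) by exists 0%N.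
have [_ [[n ->] maxn]] := noetherian_maximal idF F0.
have stable c : multiples s (c *: (b ^+ n.+1 *: x)) ->
    multiples s (c *: (b ^+ n *: x)).
  suff eq_colon : colon (multiples s) (b ^+ n.+1 *: x)
                  = colon (multiples s) (b ^+ n *: x).
    by rewrite -![multiples s _]/(colon _ _ c) eq_colon.
  by apply: maxn; [exists n.+1 | rewrite exprS -scalerA; exact: sub_colonZ].
exists (b ^+ n *: x) => /=; split=> //.
  move=> w [Kyc [y [c [Ly qc wE]]]]; move: Kyc; rewrite wE => Kyc.
  apply: submoduleD => //; apply: stable.
  rewrite exprS -scalerA scalerA mulrC -scalerA; apply: bK.
  by apply: (submodule_addl subK (multiples_firsts Ly)); rewrite addrC.
move=> a [y [c [Ly qc azE]]]; rewrite -(subrK c a).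
apply: (submoduleD idq) => //; apply: pq; apply: (prime_idealX (n := n) pp pb).
rewrite px /colon /= mulrC -scalerA scalerBl azE addrK.
exact: multiples_firsts.
Qed.

Hypothesis extendC : forall (s : seq X) (F : seq (set R)),
  (forall f, f \in F -> C f) ->
  exists q p, [/\ C q, q \notin F, assoc (span s) p, p `<=` q &
                  forall f, f \in F -> ~ f `<=` p].

(** Iterating [witnesses_extend] gives an increasing sequence of sums of
    multiples; each [q_i] is the annihilator of [z_i] modulo their union. *)
Lemma exists_infinite_assoc : exists2 L, submodule L & infinite_set (assoc L).
Proof.
have [|f f0 /all_and2[Cf fS]] := @dependent_chain _ (witnesses C)
    (fun s t => exists zq, t = zq :: s) [::] I.
  move=> s Cs; have [f|q [p [Cq qs ap pq sp]]] := @extendC [seq zq.1 | zq <- s]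
    [seq zq.2 | zq <- s]; first exact: witnesses_mem.
  have [z Cz] := witnesses_extend Cs ap Cq pq qs sp.
  by exists ((z, q) :: s) => //; exists (z, q).
have Lmono m n : (m <= n)%N -> multiples (f m) `<=` multiples (f n).
  move=> /subnK <-; elim: (n - m)%N => [|k IHk] //.
  apply: subset_trans IHk _; rewrite addSn; have [[z q] fE] := fS (k + m)%N.
  have := Cf (k + m).+1; rewrite fE => -[_ [/primeC[idq _ _] _] _ _].
  exact: sub_adjoin.
have Kmono m n : (m <= n)%N -> firsts (f m) `<=` firsts (f n).
  move=> /subnK <-; elim: (n - m)%N => [|k IHk] //.
  apply: subset_trans IHk _; rewrite addSn; have [zq ->] := fS (k + m)%N.
  exact: sub_adjoin.
have KL m n : firsts (f m) `&` multiples (f n) `<=` multiples (f m).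
  have [mn|/ltnW/Lmono nm] := leqP m n; last by move=> x [_ /nm].
  rewrite -(subnK mn); elim: (n - m)%N => [|k IHk] x [Kx]; first by [].
  rewrite addSn => Lx; apply: IHk; split=> //.
  have := Cf (k + m).+1; have [[z q] fE] := fS (k + m)%N; rewrite fE => -[_ _ KLs _].
  by apply: KLs; split; [exact: (Kmono m _ (leq_addl _ _)) | rewrite -fE].
pose L := \bigcup_n multiples (f n).
have subL : submodule L.
  split=> [|a x y [m _ fx] [n _ fy]]; first by exists 0%N; rewrite ?f0.
  exists (maxn m n) => //; apply: (submodule_multiples (Cf _)).2.
    exact: Lmono (leq_maxl m n) _ fx.
  exact: Lmono (leq_maxr m n) _ fy.
exists L => //; have assocL n r : r \in [seq zq.2 | zq <- f n] -> assoc L r.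
  elim: n => [|n IHn]; first by rewrite f0.
  have := Cf n.+1; have [[z q] fE] := fS n; rewrite fE.
  move=> [_ [Cq _] _ zq]; rewrite inE => /orP[/eqP ->|/IHn //].
  split; [exact: primeC | exists z => //].
  apply/seteqP; split=> [a qa|a [m _ La]].
    exists n.+1 => //; rewrite fE; exists 0, a; rewrite add0r; split=> //.
    exact: submodule0 (submodule_multiples (Cf n)).
  have Kaz : firsts (f n.+1) (a *: z).
    apply: submoduleZ; first exact: submodule_span.
    by apply: mem_span; rewrite fE mem_head.
  by have := KL n.+1 m _ (conj Kaz La); rewrite fE => /zq.
(* A finite set of associated primes of size [n] cannot contain the [n + 1]
   distinct primes of the list [f n.+1]. *)
have uniqC s : witnesses C s -> uniq [seq zq.2 | zq <- s].
  by elim: s => //= -[z q] t IHt [/IHt -> [_ ->]].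
have sizef n : size (f n) = n.
  by elim: n => [|n IHn]; [rewrite f0 | have [zq ->] := fS n; rewrite /= IHn].
move=> /finite_seqP[t assocE].
have /uniq_leq_size : uniq [seq zq.2 | zq <- f (size t).+1] by exact: uniqC.
move=> /(_ t); rewrite size_map sizef ltnn => sub_t.
by suff: false by []; apply: sub_t => q /assocL; rewrite assocE.
Qed.

End Construction.

(** * Finite support from finiteness of associated primes *)

Definition variety p : set (set R) := [set q | prime_ideal q /\ p `<=` q].

(** The support is the union of the sets [variety p] over the associated
    primes [p]. *)
Lemma variety_assoc_finite_supp L : submodule L -> finite_set (assoc L) ->
  (forall p, assoc L p -> finite_set (variety p)) -> finite_set (supp L).
Proof.
move=> subL finA finV; apply: sub_finite_set (bigcup_finite finA finV).
by move=> q Lq; have [p ap pq] := supp_assoc subL Lq; exists p => //; case: Lq.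
Qed.

(** The set [C] from which the [q_i] are taken consists of the primes strictly
    above a bad prime [p] that lies in every support, or of the maximal bad
    primes when there is no such [p]. *)
Lemma finite_assoc_finite_supp :
  (forall L, submodule L -> finite_set (assoc L)) ->
  exists s, finite_set (supp (span s)).
Proof.
move=> finA; apply: contrapT => /forallNP infS.
pose bad p := prime_ideal p /\ infinite_set (variety p).
have badS s : exists2 p, bad p & supp (span s) p.
  apply: contrapT => nobad; apply: (infS s).
  apply: variety_assoc_finite_supp => [||p ap]; first exact: submodule_span.
    exact/finA/submodule_span.
  apply: contrapT => infp; apply: nobad.
  by exists p; [split=> //; case: ap | exact: assoc_supp].
suff [C primeC extendC] : exists2 C : set (set R), C `<=` @prime_ideal R &
    forall s (F : seq (set R)), (forall f, f \in F -> C f) ->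
    exists q p, [/\ C q, q \notin F, assoc (span s) p, p `<=` q &
                    forall f, f \in F -> ~ f `<=` p].
  have [L /finA] := exists_infinite_assoc primeC extendC.
  by move=> finL /(_ finL).
have [[p [[pp infp] suppp]]|nop] :=
  pselect (exists p, bad p /\ forall s, supp (span s) p).
  (* A prime of [F] below [p' `<=` p] would be equal to [p]. *)
  exists (variety p `\ p) => [q [[] //]|s F FC].
  have /infinite_setN0[q [[[qq pq] qp] qF]] :
      infinite_set ((variety p `\ p) `\` [set` F]).
    by do 2![apply: infinite_setD => //]; exact: finite_seq.
  have [p' ap' p'p] := supp_assoc (submodule_span s) (suppp s).
  exists q, p'; split=> //; first exact/negP.
    exact: subset_trans p'p pq.
  move=> f /FC[[ff pf] fp] fp'; apply: fp; apply/seteqP; split=> //.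
  exact: subset_trans fp' p'p.
exists [set q | bad q /\ forall p, bad p -> q `<=` p -> p = q] => [q [[]] //|s F FC].
(* Enlarging [span s] removes the finitely many primes of [F] from the support,
   which still contains a bad prime and hence a maximal one. *)
have [t Ft] : exists t, forall f, f \in F -> ~ supp (span t) f.
  elim: F FC => [|f F IHF] FC; first by exists [::].
  have [|t Ft] := IHF; first by move=> g gF; apply: FC; rewrite inE gF orbT.
  have [u fu] : exists u, ~ supp (span u) f.
    apply: contrapT => /forallNP fS; apply: nop; exists f; split.
      by case: (FC f (mem_head _ _)).
    by move=> u; exact: contrapT (fS u).
  exists (u ++ t) => g; rewrite inE => /orP[/eqP ->|].
    by move=> /(supp_anti (@span_catl _ _ u t)).
  by move=> /Ft gt /(supp_anti (@span_catr _ _ u t)).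
have [p badp suppp] := badS (s ++ t).
have [|q [[badq pq] maxq]] :=
    @noetherian_maximal [set q | bad q /\ p `<=` q] p _ (conj badp (fun _ => id)).
  by move=> I [[[] //]].
have suppq : supp (span (s ++ t)) q by apply: supp_up suppp _ pq; case: badq.
have [p' ap' p'q] := supp_assoc (submodule_span s)
  (supp_anti (@span_catl _ _ s t) suppq).
have qF : q \notin F.
  by apply/negP => /Ft; apply; exact: supp_anti (@span_catr _ _ s t) _ suppq.
exists q, p'; split=> //.
  by split=> // r badr qr; apply: maxq => //; split=> //; exact: subset_trans pq qr.
move=> f fF fp'; have [_ maxf] := FC f fF.
by move: qF; rewrite (maxf q badq (subset_trans fp' p'q)) fF.
Qed.

(** * Making every prime of the support associated *)

Lemma minimal_supp_assoc L p : submodule L -> supp L p ->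
  (forall q, supp L q -> q `<=` p -> q = p) -> assoc L p.
Proof.
move=> subL Lp minp; have [q aq qp] := supp_assoc subL Lp.
by rewrite -(minp q) //; exact: assoc_supp.
Qed.

(** The submodule of [X / L] generated by [z] is a copy of [R / p], and
    dividing by [q z] turns it into [R / q]. *)
Lemma assoc_adjoin L p q z : submodule L -> prime_ideal q ->
  p = colon L z -> p `<=` q -> assoc (adjoin L q z) q.
Proof.
move=> subL [idq q1 qM] pz pq; split=> //; exists z => //.
apply/seteqP; split=> [a qa|a [y [b [Ly qb azE]]]].
  by exists 0, a; rewrite add0r; split=> //; exact: submodule0 subL.
rewrite -(subrK b a); apply: (submoduleD idq) => //; apply: pq.
by rewrite pz /colon /= scalerBl azE addrK.
Qed.

(** Nonzero elements of [R z] modulo [L] have annihilator [p], and those of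
    [R y] have annihilator [r]. As [r] differs from [p], these submodules of
    [X / L] meet trivially, so [R y] embeds in the quotient by [q z]. *)
Lemma assoc_adjoin_stable L p q r z : submodule L -> ideal q -> prime_ideal p ->
  p = colon L z -> assoc L r -> r <> p -> assoc (adjoin L q z) r.
Proof.
move=> subL idq pp pz [pr [y _ ry]] rp; split=> //; exists y => //.
apply/seteqP; split=> a; first by rewrite ry => Lay; exact: sub_adjoin.
move=> [x [b [Lx qb ayE]]]; apply: contrapT => ra; apply: rp.
have eqc : colon L (a *: y) = colon L (b *: z).
  apply/seteqP; split=> c; rewrite /colon /= ayE scalerDr.
    by rewrite addrC; apply: submodule_addl => //; exact: submoduleZ.
  by move=> ?; apply: submoduleD => //; exact: submoduleZ.
rewrite -(assoc_colon_mul pr ry ra) eqc; apply: (assoc_colon_mul pp pz).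
move=> pb; apply: ra; rewrite ry /colon /= ayE.
by apply: submoduleD => //; rewrite pz in pb.
Qed.

(** Let [S] be a minimal element among the supports of the quotients by
    finitely generated submodules. The primes of [S] are made associated one
    after the other by [assoc_adjoin]. The step for [q] uses an associated prime
    [p] below [q] and minimal in [S]; only [p] could be lost in that step
    ([assoc_adjoin_stable]), and it is not, because the support is still [S] and
    minimal primes of a support are associated. *)
Lemma exists_supp_eq_assoc s0 : finite_set (supp (span s0)) ->
  exists s, supp (span s) = assoc (span s) /\ finite_set (supp (span s)).
Proof.
move=> finS0; pose F : set (set (set R)) := [set S | exists s, S = supp (span s)].
have [|S [SS0 [s1 Ss1] minS]] := @finite_minimal _ F _ finS0; first by exists s0.
have finS : finite_set S := sub_finite_set SS0 finS0.
have minimal_below q : S q -> exists p,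
    [/\ S p, p `<=` q & forall r, S r -> r `<=` p -> r = p].
  move=> Sq; pose below p := [set r | S r /\ r `<=` p].
  have finq : finite_set (below q) by apply: sub_finite_set finS => r [].
  have [|B [Bq [p Sp BE] minB]] :=
    @finite_minimal _ [set below p | p in S] _ finq; first by exists q.
  rewrite -{}BE in Bq minB.
  have [_ pq] : below q p by apply: Bq; split.
  exists p; split=> // r Sr rp; apply/seteqP; split=> //.
  have rE : below r = below p.
    apply: minB; first by exists r.
    by move=> u [Su ur]; split=> //; exact: subset_trans ur rp.
  by have [] : below r p by rewrite rE; split.
suff allS (l : seq (set R)) : (forall q, q \in l -> S q) ->
    exists s, S = supp (span s) /\ forall q, q \in l -> assoc (span s) q.
  have /finite_seqP[l Sl] := finS.
  have [|s [Ss las]] := allS l; first by move=> q ql; rewrite Sl.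
  exists s; rewrite -Ss; split=> //; apply/seteqP; split=> q.
    by rewrite Sl => /las.
  by rewrite Ss => /assoc_supp.
elim: l => [|q l IHl] lS; first by exists s1.
have [|s [Ss las]] := IHl; first by move=> r rl; apply: lS; rewrite inE rl orbT.
have Sq : S q by apply: lS; rewrite mem_head.
have subs := submodule_span s.
have assoc_min t p : S = supp (span t) -> S p ->
    (forall r, S r -> r `<=` p -> r = p) -> assoc (span t) p.
  by move=> -> Sp minp; apply: minimal_supp_assoc => //; exact: submodule_span.
have [p [Sp pq minp]] := minimal_below q Sq.
have [pp [z _ pz]] := assoc_min s p Ss Sp minp.
have qq : prime_ideal q by move: Sq; rewrite Ss => -[].
have [idq _ _] := qq.
have [g qg] := noetherian_ideal_span idq.
pose s' := [seq a *: z | a <- g] ++ s.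
have s'E : span s' = adjoin (span s) q z.
  by rewrite /span add_span_cat qg adjoin_span.
have Ss' : S = supp (span s').
  apply/esym/minS; first by exists s'.
  by rewrite Ss; apply: supp_anti; exact: span_catr.
exists s'; split=> // r; rewrite inE => /orP[/eqP ->|/las ar].
  by rewrite s'E; exact: assoc_adjoin pz pq.
have [->|/eqP rp] := eqVneq r p; first exact: assoc_min.
by rewrite s'E; exact: assoc_adjoin_stable pz ar rp.
Qed.

End Noetherian.

(** * Quotient modules and localizations *)

Section Quotients.
Variables (R : comNzRingType) (X : lmodType R) (L : submodClosed X).

Lemma quot_annihilator (x : X) a :
  (a *: (\pi_(quot_mod L) x) = 0) <-> colon [set` L] x a.
Proof.
have pi0 : \pi_(quot_mod L) 0 = 0.
  by rewrite -[in LHS](scale0r 0) pi_quot_scale; exact: scale0r.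
have -> : a *: \pi_(quot_mod L) x = \pi_(quot_mod L) (a *: x).
  by rewrite pi_quot_scale.
by rewrite -pi0; split=> [/eqP|Lax]; [|apply/eqP]; rewrite quot_mod_eqE subr0.
Qed.

Lemma Ass_quot : Ass (quot_mod L) = assoc [set` L].
Proof.
apply/seteqP; split=> p.
  move=> [P pP [x px]]; split; first by apply/prime_ideal_bundle; exists P.
  exists (repr x) => //; rewrite px; apply/seteqP.
  by split=> a; rewrite /= -[x in a *: x]reprK; move=> /quot_annihilator.
move=> [/prime_ideal_bundle[P pP] [x _ px]]; exists P => //.
exists (\pi_(quot_mod L) x); rewrite px; apply/seteqP.
by split=> a /quot_annihilator.
Qed.

Lemma localization_neq0 (Y : lmodType R) (P : prime_idealr R) :
  (exists y : localization Y P, y <> 0) <->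
  exists y : Y, forall a, a *: y = 0 -> a \in P.
Proof.
split=> [[z z0]|[y yP]].
  exists (repr z).1 => a az; apply: contrapT => /negP aP; apply: z0.
  rewrite -[z]reprK; apply/loc_eqP; exists (Sub a aP : denom P) => /=.
  by rewrite scale1r scaler0 subr0.
exists (\pi_(localization Y P) (y, denom1 P)) => /loc_eqP[u] /=.
by rewrite scaler0 subr0 scale1r => /yP; apply/negP/(valP u).
Qed.

Lemma Supp_quot : Supp (quot_mod L) = supp [set` L].
Proof.
apply/seteqP; split=> p.
  move=> [P pP /localization_neq0[y yP]].
  split; first by apply/prime_ideal_bundle; exists P.
  by exists (repr y) => a /quot_annihilator; rewrite reprK pP; exact: yP.
move=> [/prime_ideal_bundle[P pP] [x xp]]; exists P => //.
apply/localization_neq0; exists (\pi_(quot_mod L) x) => a.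
by move=> /quot_annihilator /xp; rewrite pP.
Qed.

End Quotients.

Theorem theorem2p1 (R : comNzRingType) (hR : noetherian R) (M : lmodType R) :
  [<-> weakly_Laskerian M;
       exists N : submodClosed M,
         [/\ fin_gen N,
             Supp (quot_mod N) = Ass (quot_mod N) &
             finite_set (Supp (quot_mod N))];
       FSF M].
Proof.
tfae.
- move=> wL.
  have [|s0 finS0] := @finite_assoc_finite_supp R hR M.
    by move=> _ /submodule_bundle[L <-]; rewrite -Ass_quot; exact: wL.
  have [s [supp_assoc finS]] := exists_supp_eq_assoc hR finS0.
  have [N Ns] := submodule_bundle (submodule_span s).
  exists N; rewrite Supp_quot Ass_quot Ns; split=> //.
  by apply/fin_gen_span; exists s.
- by move=> [N [fgN _ finN]]; exists N.
- move=> [N /fin_gen_span[s Ns] finN] L; rewrite Ass_quot.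
  apply: (finite_supp_finite_assoc hR (s := s)).
    by rewrite -Ns -Supp_quot.
  exact: submodule_submodClosed.
Qed.
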